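(* Let $\mathcal{B}$ be the family of all boundary functions on $X$, with the equivalence relation $\phi\approx\psi$ if and only if $\phi^-=\psi^-$. Let $\mathcal{S}$ be the family of all ideal sets in $P$, with the equivalence relation $\sigma\approx\tau$ if and only if $\phi_\sigma^-=\phi_\tau^-$. Then the mapping $\mathcal{S}\to\mathcal{B}$, $\sigma\mapsto\phi_\sigma$, is not injective, but it induces a bijection of $\mathcal{S}/{\approx}$ onto $\mathcal{B}/{\approx}$, given by $[\sigma]\mapsto[\phi_\sigma]$.
   Context: Setting. $X$ is a Cantor space. $G\subseteq X\times X$ is the groupoid (spectrum) of a simple AF C*-algebra $B$ relative to a canonical masa $D\cong C(X)$: $G$ is an equivalence relation on $X$, equal to the union of the graphs of the partial homeomorphisms of $X$ induced by the matrix units of a matrix unit system for $B$. $G$ is a principal groupoid with product $(w,x)\circ(x,z)=(w,z)$ and inverse $(w,x)^{-1}=(x,w)$, and is a topological groupoid in the topology generated by declaring these graphs open (each graph is also compact; this topology is in general not the relative product topology). The map $x\mapsto(x,x)$ is a homeomorphism of $X$ onto an open compact subset of $G$, and $X$ is identified with this diagonal. The coordinate projections $\pi_1,\pi_2$ restricted to $G$ are local homeomorphisms. A $G$-set is an open set on which $\pi_1$ and $\pi_2$ are one-to-one; neighborhoods of points of $G$ are always taken to be $G$-sets. Each equivalence class $\operatorname{orb}_y=\{x: (x,y)\in G\}$ is countable and dense in $X$. There is a continuous injective function $b:X\to\mathbb{R}$, and $P=\{(x,y)\in G: b(x)\le b(y)\}$ (the spectrum of a trivially analytic subalgebra $A\subseteq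 B$); $P$ is open in $G$, $P\circ P\subseteq P$, $P\cap P^{-1}=X$, $P\cup P^{-1}=G$. The total order on $X$ is $x\preceq y\iff b(x)\le b(y)$; its order topology is the original topology of $X$, and it agrees with $P$ on each equivalence class. $X$ has a minimal element $p_{\min}$ and a maximal element $p_{\max}$. Sups and infs are taken in $(X,\preceq)$ (so $\sup\emptyset=p_{\min}$). If $x\prec y$ and the open order interval with endpoints $x,y$ is empty, then $x$ has a gap above, $y$ has a gap below, $x=\operatorname{pred}y$, $y=\operatorname{succ}x$. An ideal set is an open subset $\sigma$ of $P$ such that $(w,x),(y,z)\in P$ and $(x,y)\in\sigma$ imply $(w,z)\in\sigma$. The boundary function for an ideal set $\sigma$ is $\phi_\sigma:X\to X$, $\phi_\sigma(y)=\sup\{x\in\operatorname{orb}_y:(x,y)\in\sigma\}$. A boundary function is a function $\phi:X\to X$ such that: (1) $\phi(y)\preceq y$ for all $y$; (2) whenever $\phi(y)$ has a gap below: (a) $(\phi(y),y)\in P$, (b) $y$ has a gap below, (c) $y\prec z$ implies $\phi(y)\prec\phi(z)$, (d) there is a neighborhood $N$ of $(\phi(y),y)$ such that $(s,t)\in N$ implies $s\preceq\phi(t)$; (3) $y\prec z$ implies $\phi(y)\preceq\phi(z)$; (4) if $y$ does not have a gap below, then $\phi(y)=\sup\{\phi(t): t\prec y\}$. (The function $\phi_\sigma$ is a boundary function for every ideal set $\sigma$.) For a boundary function $\phi$: $\phi^-(y)=\phi(y)$ if $\phi(y)$ has no gap below and $\phi^-(y)=\operatorname{pred}\phi(y)$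 if $\phi(y)$ has a gap below. *)

(* Defs.v *)
From HB Require Import structures.
From mathcomp Require Import all_boot all_order all_algebra.
From mathcomp Require Import all_classical all_reals topology.
From mathcomp Require Import normedtype cantor.

Set Implicit Arguments.
Unset Strict Implicit.
Unset Printing Implicit Defensive.

Import Order.TTheory GRing.Theory Num.Theory.
Import numFieldTopology.Exports numFieldNormedType.Exports.
Local Open Scope classical_set_scope.
Local Open Scope ring_scope.
Local Open Scope quotient_scope.

Definition is_cantor_space (X : topologicalType) : Prop :=
  exists (f : cantor_space -> X) (g : X -> cantor_space),
    [/\ continuous f, continuous g, cancel f g & cancel g f].

(* The spatial data of a matrix unit system for a unital AF C*-algebra
   B = lim B_n with canonical masa D = C(X).  B_n is the direct sum over
   [k : mu_blk n] of full matrix algebras of size [mu_dim k], with matrix units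
   e_ij^(n,k).  The projection e_ii is the indicator function of [mu_dom k i],
   and e_ij induces the partial homeomorphism [mu_act k i j] of X, with domain
   [mu_dom k j] and range [mu_dom k i]; the values of [mu_act k i j] outside
   [mu_dom k j] are irrelevant. *)
Record matrix_units (X : Type) := MatrixUnits {
  mu_blk : nat -> finType ;
  mu_dim : forall n, mu_blk n -> nat ;
  mu_dom : forall n (k : mu_blk n), 'I_(mu_dim k) -> set X ;
  mu_act : forall n (k : mu_blk n), 'I_(mu_dim k) -> 'I_(mu_dim k) -> X -> X }.

Section Groupoid.
Context {X : topologicalType} (M : matrix_units X).

(* The graph of the partial homeomorphism y |-> x is the set of pairs (x, y),
   so that composition of maps is the groupoid product (w,x)o(x,z) = (w,z). *)
Definition mu_graph n (k : mu_blk M n) (i j : 'I_(mu_dim k)) : set (X * X) :=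
  [set p | mu_dom j p.2 /\ p.1 = mu_act i j p.2].

Record is_matrix_unit_system : Prop := {
  mu_clopen : forall n (k : mu_blk M n) (i : 'I_(mu_dim k)), clopen (mu_dom i) ;
  mu_neq0 : forall n (k : mu_blk M n) (i : 'I_(mu_dim k)), mu_dom i !=set0 ;
  (* the e_ii of level n are orthogonal projections with sum 1 *)
  mu_partition : forall n (x : X),
    exists! e : {k : mu_blk M n & 'I_(mu_dim k)}, mu_dom (tagged e) x ;
  mu_continuous : forall n (k : mu_blk M n) (i j : 'I_(mu_dim k)),
    {within mu_dom j, continuous (mu_act i j)} ;
  mu_range : forall n (k : mu_blk M n) (i j : 'I_(mu_dim k)) x,
    mu_dom j x -> mu_dom i (mu_act i j x) ;
  mu_id : forall n (k : mu_blk M n) (i : 'I_(mu_dim k)) x,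
    mu_dom i x -> mu_act i i x = x ;
  (* e_ij e_jl = e_il *)
  mu_comp : forall n (k : mu_blk M n) (i j l : 'I_(mu_dim k)) x,
    mu_dom l x -> mu_act i j (mu_act j l x) = mu_act i l x ;
  (* each matrix unit of B_n is a sum of matrix units of B_(n+1) *)
  mu_refine : forall n (k : mu_blk M n) (i j : 'I_(mu_dim k)) p,
    mu_graph i j p ->
    exists (k' : mu_blk M n.+1) (i' j' : 'I_(mu_dim k')),
      mu_graph i' j' p /\ mu_graph i' j' `<=` mu_graph i j ;
  (* the diagonal matrix units generate D = C(X) *)
  mu_basis : forall (U : set X) x, open U -> U x ->
    exists n (k : mu_blk M n) (i : 'I_(mu_dim k)),
      mu_dom i x /\ mu_dom i `<=` U }.

Definition mu_graphs : set (set (X * X)) :=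
  [set A | exists n (k : mu_blk M n) (i j : 'I_(mu_dim k)), A = mu_graph i j].

Definition G_rel : set (X * X) := \bigcup_(A in mu_graphs) A.

Definition orb (y : X) : set X := [set x | G_rel (x, y)].

(* B is simple iff its spectrum is minimal, i.e. every orbit is dense. *)
Definition minimal_groupoid : Prop := forall y, dense (orb y).

(* G carries the topology generated by the graphs of the matrix units, not the
   topology induced by X * X; hence the type alias. *)
Definition groupoid : Type := set_type G_rel.

HB.instance Definition _ := Choice.on groupoid.
HB.instance Definition _ := @isSubBaseTopological.Build groupoid
  (set (X * X)) mu_graphs (fun A => [set g : groupoid | A (val g)]).

Definition G_open (A : set (X * X)) : Prop :=
  A `<=` G_rel /\ open [set g : groupoid | A (val g)].

Definition is_G_set (N : set (X * X)) : Prop :=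
  [/\ G_open N,
      forall p q, N p -> N q -> p.1 = q.1 -> p = q &
      forall p q, N p -> N q -> p.2 = q.2 -> p = q].

End Groupoid.

Section TotalOrder.
Context {R : realType} {X : ptopologicalType} (b : X -> R).

Definition preceq (x y : X) : Prop := b x <= b y.
Definition prec (x y : X) : Prop := b x < b y.

Definition is_sup (A : set X) (s : X) : Prop :=
  (forall x, A x -> preceq x s) /\
  (forall u, (forall x, A x -> preceq x u) -> preceq s u).

(* When X is compact and b continuous and injective, every subset of X has
   exactly one supremum, so the default value of [get] is never used. *)
Definition osup (A : set X) : X := get (is_sup A).

Definition is_pred (x y : X) : Prop :=
  prec x y /\ forall z, ~ (prec x z /\ prec z y).

Definition gap_below (y : X) : Prop := exists x, is_pred x y.

Definition pred_of (y : X) : X := get [set x | is_pred x y].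

Definition minus (phi : X -> X) (y : X) : X :=
  if `[< gap_below (phi y) >] then pred_of (phi y) else phi y.

End TotalOrder.

Section IdealsAndBoundaries.
Context {R : realType} {X : ptopologicalType} (M : matrix_units X) (b : X -> R).

Definition P_rel : set (X * X) := [set p | G_rel M p /\ preceq b p.1 p.2].

Definition is_ideal_set (sigma : set (X * X)) : Prop :=
  [/\ sigma `<=` P_rel, G_open M sigma &
      forall w x y z, P_rel (w, x) -> P_rel (y, z) -> sigma (x, y) ->
        sigma (w, z)].

Definition boundary_of (sigma : set (X * X)) (y : X) : X :=
  osup b [set x | orb M y x /\ sigma (x, y)].

Record is_boundary_function (phi : X -> X) : Prop := {
  bf_le : forall y, preceq b (phi y) y ;
  bf_gap : forall y, gap_below b (phi y) ->
    [/\ P_rel (phi y, y),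
        gap_below b y,
        forall z, prec b y z -> prec b (phi y) (phi z) &
        exists N, [/\ is_G_set M N, N (phi y, y) &
          forall s t, N (s, t) -> preceq b s (phi t)]] ;
  bf_mono : forall y z, prec b y z -> preceq b (phi y) (phi z) ;
  bf_sup : forall y, ~ gap_below b y ->
    phi y = osup b [set phi t | t in [set t | prec b t y]] }.

Definition ideal_set : Type := set_type [set sigma | is_ideal_set sigma].
Definition boundary_function : Type :=
  set_type [set phi | is_boundary_function phi].

HB.instance Definition _ := Choice.on ideal_set.
HB.instance Definition _ := Choice.on boundary_function.

Definition bf_equiv (phi psi : boundary_function) : bool :=
  `[< minus b (val phi) = minus b (val psi) >].

Definition ideal_equiv (sigma tau : ideal_set) : bool :=
  `[< minus b (boundary_of (val sigma)) = minus b (boundary_of (val tau)) >].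

Lemma bf_equiv_refl : reflexive bf_equiv.
Proof. by move=> x; apply/asboolP. Qed.

Lemma bf_equiv_sym : symmetric bf_equiv.
Proof. by move=> x y; apply/asboolP/asboolP. Qed.

Lemma bf_equiv_trans : transitive bf_equiv.
Proof. by move=> y x z /asboolP xy /asboolP yz; apply/asboolP; rewrite xy. Qed.

Canonical bf_equiv_rel :=
  EquivRel bf_equiv bf_equiv_refl bf_equiv_sym bf_equiv_trans.

Lemma ideal_equiv_refl : reflexive ideal_equiv.
Proof. by move=> x; apply/asboolP. Qed.

Lemma ideal_equiv_sym : symmetric ideal_equiv.
Proof. by move=> x y; apply/asboolP/asboolP. Qed.

Lemma ideal_equiv_trans : transitive ideal_equiv.
Proof. by move=> y x z /asboolP xy /asboolP yz; apply/asboolP; rewrite xy. Qed.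

Canonical ideal_equiv_rel :=
  EquivRel ideal_equiv ideal_equiv_refl ideal_equiv_sym ideal_equiv_trans.

Definition ideal_class : Type := {eq_quot ideal_equiv}.
Definition bf_class : Type := {eq_quot bf_equiv}.

Definition class_of_ideal (sigma : ideal_set) : ideal_class :=
  \pi_({eq_quot ideal_equiv}) sigma.
Definition class_of_bf (phi : boundary_function) : bf_class :=
  \pi_({eq_quot bf_equiv}) phi.

End IdealsAndBoundaries.

(* Main.v *)
Require Import Defs.
From mathcomp Require Import all_boot all_order all_algebra.
From mathcomp Require Import all_classical all_reals topology.
From mathcomp Require Import normedtype cantor derive.
Import Order.TTheory Num.Theory.
Import numFieldTopology.Exports numFieldNormedType.Exports.
Local Open Scope classical_set_scope.
Local Open Scope ring_scope.

Set Implicit Arguments.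
Unset Strict Implicit.
Unset Printing Implicit Defensive.

(** A point (x, y) of the groupoid has arbitrarily small neighbourhoods that are
    graphs of injective partial homeomorphisms h with h y = x
    ([G_openP], [graph_nbhs_lift]), and by simplicity every orbit is dense.

    Let sigma be an ideal set and (x, y) in sigma.  Then (h t, t) is in sigma for
    all t close to y.  If z lies above y, density provides such a t below z in the
    orbit of z, and the ideal property moves (h t, t) to (h t, z); since h t can be
    chosen close to x, the boundary function of sigma is monotone
    ([boundary_mono]).  If y has no gap below, points t below y approximate y,
    which gives left continuity ([boundary_sup]).  If the boundary value x at y has
    a gap below, the supremum defining it is attained, and h, being injective and
    continuous, takes values strictly above x at all other points close to y
    ([boundary_gap_lift]).  Such a point t cannot lie below y, by monotonicity, so
    y has a gap below; and as y is not isolated, such t exist above y in every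
    orbit, so the boundary function increases strictly after y.

    Conversely, a boundary function phi is recovered exactly, not just up to
    equivalence, from the ideal set [ideal_below phi], the interior of the part of
    P on or below the graph of phi ([ideal_below_boundary]).  Hence the map from
    ideal sets to boundary functions is onto, and since the two equivalence
    relations correspond under this map by definition, it induces a bijection of
    the classes.

    The map is not injective: if p is the minimum of X, removing the single point
    (p, p) from P leaves an ideal set, and does not change the boundary function,
    because the supremum of the empty set is p. *)

(** * The topology of the groupoid *)

Section GraphTopology.
Context {X : topologicalType} (M : matrix_units X).

(** By [G_openP] these are the neighbourhoods of p in the groupoid; the subset A
    of X * X stands for its trace on the groupoid. *)
Definition graph_nbhs (p : X * X) (A : set (X * X)) : Prop :=
  exists n (k : mu_blk M n) (i j : 'I_(mu_dim k)),
    mu_graph i j p /\ mu_graph i j `<=` A.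

Lemma graph_nbhsS p A B : A `<=` B -> graph_nbhs p A -> graph_nbhs p B.
Proof.
move=> AB [n [k [i [j [ijp ijA]]]]]; exists n, k, i, j; split => //.
exact: subset_trans AB.
Qed.

Lemma graph_nbhs_mem p A : graph_nbhs p A -> A p.
Proof. by move=> [n [k [i [j [ijp ijA]]]]]; exact: ijA. Qed.

Lemma graph_nbhs_nbhs p A :
  graph_nbhs p A -> graph_nbhs p [set q | graph_nbhs q A].
Proof.
move=> [n [k [i [j [ijp ijA]]]]]; exists n, k, i, j; split => // q ijq.
by exists n, k, i, j.
Qed.

Lemma G_relP p : G_rel M p <-> graph_nbhs p setT.
Proof.
split=> [[A [n [k [i [j ->]]]] ijp]|[n [k [i [j [ijp _]]]]]].
  by exists n, k, i, j; split.
by exists (mu_graph i j) => //; exists n, k, i, j.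
Qed.

Lemma graph_nbhs_G_rel p A : graph_nbhs p A -> G_rel M p.
Proof. by move=> /(graph_nbhsS (@subsetT _ _)) /G_relP. Qed.

Context (HM : is_matrix_unit_system M).

Lemma mu_graph_refine n m (k : mu_blk M n) (i j : 'I_(mu_dim k)) p :
  (n <= m)%N -> mu_graph i j p ->
  exists (k' : mu_blk M m) (i' j' : 'I_(mu_dim k')),
    mu_graph i' j' p /\ mu_graph i' j' `<=` mu_graph i j.
Proof.
move=> nm ijp; elim: m nm => [|m IH].
  by rewrite leqn0 => /eqP n0; subst n; exists k, i, j; split.
rewrite leq_eqVlt => /predU1P[n_eq|]; first by subst n; exists k, i, j; split.
rewrite ltnS => /IH[k' [i' [j' [ijp' sub']]]].
have [k2 [i2 [j2 [ijp2 sub2]]]] := mu_refine HM ijp'.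
by exists k2, i2, j2; split => //; exact: subset_trans sub'.
Qed.

Lemma mu_dom_inj n (k k' : mu_blk M n) (i : 'I_(mu_dim k))
    (i' : 'I_(mu_dim k')) x :
  mu_dom i x -> mu_dom i' x ->
  Tagged (fun k : mu_blk M n => 'I_(mu_dim k)) i = Tagged _ i'.
Proof.
move=> ix i'x; have [e [_ e_uniq]] := mu_partition HM n x.
by rewrite -(e_uniq (Tagged _ i)) // -(e_uniq (Tagged _ i')).
Qed.

Lemma mu_graph_dom n (k : mu_blk M n) (i j : 'I_(mu_dim k)) p :
  mu_graph i j p -> mu_dom i p.1 /\ mu_dom j p.2.
Proof. by move=> [jp ->]; split=> //; exact: (mu_range HM). Qed.

Lemma mu_graph_comp n (k k' : mu_blk M n) (i j : 'I_(mu_dim k))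
    (i' j' : 'I_(mu_dim k')) x y z :
  mu_graph i j (x, y) -> mu_graph i' j' (y, z) ->
  graph_nbhs (x, z)
    [set q | exists t, mu_graph i j (q.1, t) /\ mu_graph i' j' (t, q.2)].
Proof.
move=> ijxy i'j'yz.
have E : Tagged (fun k : mu_blk M n => 'I_(mu_dim k)) j = Tagged _ i'.
  exact: mu_dom_inj (proj2 (mu_graph_dom ijxy)) (proj1 (mu_graph_dom i'j'yz)).
have kk' : k = k' := congr1 tag E.
subst k'; move/eqP: E; rewrite eq_Tagged /= => /eqP E; subst i'.
exists n, k, i, j'; split.
  case: ijxy => /= _ ->; case: i'j'yz => /= zj' ->; split => //=.
  by rewrite (mu_comp HM).
move=> [s u] [/= uj' ->]; exists (mu_act j j' u); split; split => //=.
  exact: (mu_range HM).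
by rewrite (mu_comp HM).
Qed.

(** Both factors can be refined to matrix units of one level, where the
    composable ones belong to the same block. *)
Lemma graph_nbhs_comp x y z A B :
  graph_nbhs (x, y) A -> graph_nbhs (y, z) B ->
  graph_nbhs (x, z) [set q | exists t, A (q.1, t) /\ B (t, q.2)].
Proof.
move=> [n [k [i [j [ijxy ijA]]]]] [n' [k' [i' [j' [ijyz ijB]]]]].
have [k1 [i1 [j1 [g1 s1]]]] := mu_graph_refine (leq_maxl n n') ijxy.
have [k2 [i2 [j2 [g2 s2]]]] := mu_graph_refine (leq_maxr n n') ijyz.
apply: graph_nbhsS (mu_graph_comp g1 g2) => q [t [tq qt]].
by exists t; split; [exact/ijA/s1|exact/ijB/s2].
Qed.

Lemma mu_dom_refine n m (k : mu_blk M n) (i : 'I_(mu_dim k))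
    (k' : mu_blk M m) (i' : 'I_(mu_dim k')) x :
  (n <= m)%N -> mu_dom i x -> mu_dom i' x -> mu_dom i' `<=` mu_dom i.
Proof.
move=> nm ix i'x.
have : mu_graph i i (x, x) by split=> //=; rewrite (mu_id HM).
move=> /(mu_graph_refine nm)[k2 [a [c [ac_x ac_sub]]]].
have E := mu_dom_inj (proj2 (mu_graph_dom ac_x)) i'x.
have kk' : k2 = k' := congr1 tag E.
subst k2; move/eqP: E; rewrite eq_Tagged /= => /eqP E; subst c.
move=> t i't; have : mu_graph a i' (mu_act a i' t, t) by [].
by move=> /ac_sub[].
Qed.

(** The topology of the groupoid is finer than the product topology. *)
Lemma graph_nbhs_box p (U V : set X) : G_rel M p ->
  open U -> U p.1 -> open V -> V p.2 ->
  graph_nbhs p [set q | U q.1 /\ V q.2].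
Proof.
move=> /G_relP[n [k [i [j [ijp _]]]]] oU Up oV Vp.
have [n1 [k1 [i1 [i1p i1U]]]] := mu_basis HM oU Up.
have [n2 [k2 [i2 [i2p i2V]]]] := mu_basis HM oV Vp.
have le0 : (n <= maxn n (maxn n1 n2))%N by rewrite leq_maxl.
have le1 : (n1 <= maxn n (maxn n1 n2))%N by rewrite !leq_max leqnn orbT.
have le2 : (n2 <= maxn n (maxn n1 n2))%N by rewrite !leq_max leqnn !orbT.
have [k' [i' [j' [g' _]]]] := mu_graph_refine le0 ijp.
have [i'p j'p] := mu_graph_dom g'.
exists _, k', i', j'; split=> // q /mu_graph_dom[i'q j'q]; split.
  exact/i1U/(mu_dom_refine le1 i1p i'p).
exact/i2V/(mu_dom_refine le2 i2p j'p).
Qed.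

(** Of two matrix unit graphs through a point, the one of the higher level is
    contained in the other. *)
Lemma graph_nbhsI p A B :
  graph_nbhs p A -> graph_nbhs p B -> graph_nbhs p (A `&` B).
Proof.
move=> [n [k [i [j [ijp ijA]]]]] [n' [k' [i' [j' [ijp' ijB]]]]].
have [k1 [i1 [j1 [g1 s1]]]] := mu_graph_refine (leq_maxl n n') ijp.
have [k2 [i2 [j2 [g2 s2]]]] := mu_graph_refine (leq_maxr n n') ijp'.
exists _, k1, i1, j1; split=> // q qg1; split; first exact/ijA/s1.
apply/ijB/s2; move: g2 {s2}.
have [i1p j1p] := mu_graph_dom g1.
move=> g2; have [i2p j2p] := mu_graph_dom g2.
have E := mu_dom_inj i1p i2p; have E' := mu_dom_inj j1p j2p.
have kk' : k1 = k2 := congr1 tag E.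
subst k2; move/eqP: E; rewrite eq_Tagged /= => /eqP E; subst i2.
by move/eqP: E'; rewrite eq_Tagged /= => /eqP E'; subst j2.
Qed.

Lemma graph_nbhs_bigcap p (s : seq (set (X * X))) : G_rel M p ->
  (forall C, C \in s -> C p /\ mu_graphs M C) ->
  graph_nbhs p [set q | forall C, C \in s -> C q].
Proof.
move=> Gp; elim: s => [_|C s IH sP].
  by apply: graph_nbhsS (proj1 (G_relP p) Gp) => q _ C; rewrite in_nil.
have [Cp [n [k [i [j Cij]]]]] := sP C (mem_head _ _).
have Cnbhs : graph_nbhs p C.
  by exists n, k, i, j; rewrite -Cij; split.
have /IH/(graph_nbhsI Cnbhs) : forall C, C \in s -> C p /\ mu_graphs M C.
  by move=> C' C's; apply: sP; rewrite inE C's orbT.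
apply: graph_nbhsS => q [Cq sq] C'; rewrite inE => /orP[/eqP->//|].
exact: sq.
Qed.

(** As the matrix unit graphs through a point form a chain, they are not only a
    subbase but a base. *)
Lemma G_openP A : G_open M A <-> forall p, A p -> graph_nbhs p A.
Proof.
split=> [[AG [D DfinI DA]] p Ap|Anbhs].
  have AE q (Gq : G_rel M q) : A q ->
      (\bigcup_(i in D) (i : set (groupoid M))) (SigSub (mem_set Gq)).
    by move=> Aq; rewrite [X in X _]DA.
  have EA q (Gq : G_rel M q) :
      (\bigcup_(i in D) (i : set (groupoid M))) (SigSub (mem_set Gq)) -> A q.
    by rewrite [X in X _]DA.
  have Gp := AG _ Ap; have [B DB Bp] := AE _ Gp Ap.
  have [F Fsub FB] := DfinI _ DB.
  pose s : seq (set (X * X)) := finmap.enum_fset F.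
  have sgraph C : C \in s -> C p /\ mu_graphs M C.
    move=> Cs; split; last by apply/set_mem; exact: Fsub.
    by move: Bp; rewrite -FB => /(_ C Cs).
  have [n [k [i [j [ijp ijF]]]]] := graph_nbhs_bigcap Gp sgraph.
  exists n, k, i, j; split => // q ijq.
  have Gq : G_rel M q by exists (mu_graph i j) => //; exists n, k, i, j.
  apply: (EA _ Gq); exists B => //; rewrite -FB => C CF; exact: ijF CF.
split; first by move=> p /Anbhs /graph_nbhs_G_rel.
rewrite openE => g Ag; have [n [k [i [j [ijp ijA]]]]] := Anbhs _ Ag.
rewrite /interior nbhsE; exists [set g : groupoid M | mu_graph i j (val g)].
  split=> //; exists [set [set g : groupoid M | mu_graph i j (val g)]].
    move=> _ ->; apply: (finI_from1 (D := mu_graphs M)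
      (fun A => [set g : groupoid M | A (val g)])).
    by exists n, k, i, j.
  by rewrite bigcup_set1.
by move=> h /ijA.
Qed.

Lemma G_rel_refl x : G_rel M (x, x).
Proof.
have [[k i] [ix _]] := mu_partition HM 0 x.
exists (mu_graph i i); first by exists 0, k, i, i.
by split=> //=; rewrite (mu_id HM).
Qed.

Lemma G_rel_trans x y z : G_rel M (x, y) -> G_rel M (y, z) -> G_rel M (x, z).
Proof.
move=> /G_relP xy /G_relP yz; exact: graph_nbhs_G_rel (graph_nbhs_comp xy yz).
Qed.

Lemma mu_graph_G_set n (k : mu_blk M n) (i j : 'I_(mu_dim k)) :
  is_G_set M (mu_graph i j).
Proof.
split.
- by apply/G_openP => p ijp; exists n, k, i, j; split.
- move=> [x y] [x' y'] [/= jy ->] [/= jy' ->] E; congr pair => //.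
  rewrite -(mu_id HM jy) -(mu_id HM jy') -(mu_comp HM j i jy) E.
  by rewrite (mu_comp HM j i jy').
- by move=> [x y] [x' y'] [/= jy ->] [/= jy' ->] ->.
Qed.

(** A neighbourhood of (x, y) contains the graph of a partial homeomorphism
    defined around y, and this homeomorphism is injective. *)
Lemma graph_nbhs_lift x y A : graph_nbhs (x, y) A ->
  exists U, [/\ open U, U y &
    forall t, U t -> exists s, A (s, t) /\ (s = x -> t = y)].
Proof.
move=> [n [k [i [j [ijxy ijA]]]]]; exists (mu_dom j); split.
- by case: (mu_clopen HM j).
- by case: ijxy.
move=> t jt; have ijt : mu_graph i j (mu_act i j t, t) by [].
exists (mu_act i j t); split; first exact: ijA.
have [_ inj1 _] := mu_graph_G_set i j.
by move=> E; have [] := inj1 _ _ ijt ijxy E.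
Qed.

End GraphTopology.

(** * The order of a Cantor set of real numbers *)

Lemma cantor_compact_perfect (X : topologicalType) :
  is_cantor_space X ->
  compact [set: X] /\ forall x : X, ~ open [set x].
Proof.
move=> [f [g [cf cg fK gK]]]; split.
  have -> : [set: X] = f @` [set: cantor_space].
    by apply/seteqP; split=> // x _; exists (g x).
  apply: continuous_compact cantor_space_compact.
  exact: continuous_subspaceT.
move=> x ox; apply: (proj1 perfectTP cantor_perfect (g x)).
have -> : [set g x] = f @^-1` [set x].
  by apply/seteqP; split=> [_ ->|y /= <-] //=; rewrite ?gK ?fK.
by apply: open_comp ox => y _; exact: cf.
Qed.

Section Order.
Context {R : realType} {X : ptopologicalType} (b : X -> R).
Context (X_compact : compact [set: X]).
Context (b_cont : continuous b) (b_inj : injective b).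

Lemma preceq_anti x y : preceq b x y -> preceq b y x -> x = y.
Proof. by move=> xy yx; apply/b_inj/le_anti/andP. Qed.

Lemma open_above u : open [set x | prec b u x].
Proof.
rewrite (_ : [set x | _] = b @^-1` [set r | r > b u]) //.
by apply: open_comp; [move=> x _; exact: b_cont|exact: open_gt].
Qed.

Lemma open_below u : open [set x | prec b x u].
Proof.
rewrite (_ : [set x | _] = b @^-1` [set r | r < b u]) //.
by apply: open_comp; [move=> x _; exact: b_cont|exact: open_lt].
Qed.

Lemma closed_has_max (A : set X) : closed A -> A !=set0 ->
  exists2 c, A c & forall t, A t -> preceq b t c.
Proof.
move=> clA A0; have cA : compact A by exact: subclosed_compact X_compact _.
have [|c /set_mem Ac c_max] := compact_EVT_max (f := b) A0 cA.
  exact: continuous_subspaceT.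
by exists c => // t /mem_set /c_max.
Qed.

Lemma closed_has_min (A : set X) : closed A -> A !=set0 ->
  exists2 c, A c & forall t, A t -> preceq b c t.
Proof.
move=> clA A0; have cA : compact A by exact: subclosed_compact X_compact _.
have [|c /set_mem Ac c_min] := compact_EVT_min (f := b) A0 cA.
  exact: continuous_subspaceT.
by exists c => // t /mem_set /c_min.
Qed.

Lemma is_sup_osup A : is_sup b A (osup b A).
Proof.
suff [s sP] : exists s, is_sup b A s by exact: (getPex (ex_intro _ s sP)).
pose ub := [set u | forall x, A x -> preceq b x u].
have [||s ub_s s_min] := @closed_has_min ub; last by exists s.
  rewrite (_ : ub = ~` \bigcup_(x in A) [set u | prec b u x]).
    by apply/open_closedC/bigcup_open => x _; exact: open_below.
  apply/seteqP; split=> [u ubu [x Ax]|u nu x Ax].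
    by rewrite /= /prec ltNge; move/negP; apply; exact: ubu.
  by rewrite /preceq leNgt; apply/negP => ux; apply: nu; exists x.
have [||m _ mP] := @closed_has_max setT; first exact: closedT.
  by exists point.
by exists m => x _; exact: mP.
Qed.

Lemma osup_ub A x : A x -> preceq b x (osup b A).
Proof. by have [+ _] := is_sup_osup A; exact. Qed.

Lemma osup_le A u : (forall x, A x -> preceq b x u) -> preceq b (osup b A) u.
Proof. by have [_] := is_sup_osup A; exact. Qed.

Lemma osup_gt A u : prec b u (osup b A) -> exists2 x, A x & prec b u x.
Proof.
move=> uA; apply: contrapT => nA; move: uA; rewrite /prec ltNge => /negP; apply.
apply: osup_le => x Ax; rewrite /preceq leNgt; apply/negP => ux.
by apply: nA; exists x.
Qed.

Lemma osup0_le x : preceq b (osup b set0) x.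
Proof. exact: osup_le. Qed.

Lemma no_gap_between u y :
  ~ gap_below b y -> prec b u y -> exists2 z, prec b u z & prec b z y.
Proof.
move=> ny uy; apply: contrapT => nz; apply: ny; exists u; split=> // z [uz zy].
by apply: nz; exists z.
Qed.

(** The order topology is the given one: were some neighbourhood of y disjoint
    from the points strictly below y, these would form a compact set, and its
    largest element would be the predecessor of y. *)
Lemma no_gap_approx (U : set X) u y : open U -> U y ->
  ~ gap_below b y -> prec b u y -> exists2 t, U t & prec b t y.
Proof.
move=> oU Uy ny uy; apply: contrapT => nU.
have [||m [mU my] m_max] := @closed_has_max (~` U `&` ~` [set t | prec b y t]).
- by apply: closedI; apply: open_closedC => //; exact: open_above.
- exists u; split=> [Uu|/(lt_trans uy)]; last by rewrite ltxx.
  by apply: nU; exists u.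
have {}my : prec b m y.
  rewrite /prec lt_neqAle leNgt; apply/andP; split; last exact/negP.
  by apply/eqP => /b_inj E; apply: mU; rewrite E.
have [z mz zy] := no_gap_between ny my.
have : preceq b z m.
  apply: m_max; split=> [Uz|/(lt_trans zy)]; last by rewrite ltxx.
  by apply: nU; exists z.
by rewrite /preceq leNgt mz.
Qed.

End Order.

(** * From ideal sets to boundary functions *)

Section Boundaries.
Context {R : realType} {X : ptopologicalType}.
Context (M : matrix_units X) (b : X -> R).
Context (X_cantor : is_cantor_space X) (HM : is_matrix_unit_system M).
Context (B_simple : minimal_groupoid M).
Context (b_cont : continuous b) (b_inj : injective b).
Context (P_open : G_open M (P_rel M b)).

Let X_compact : compact [set: X].
Proof. by have [] := cantor_compact_perfect X_cantor. Qed.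

Let osup_ub A x : A x -> preceq b x (osup b A).
Proof. exact: osup_ub. Qed.

Let osup_le A u : (forall x, A x -> preceq b x u) -> preceq b (osup b A) u.
Proof. exact: osup_le. Qed.

Lemma P_rel_refl x : P_rel M b (x, x).
Proof. by split=> /=; [exact: G_rel_refl|exact: lexx]. Qed.

Lemma P_rel_nbhs p : P_rel M b p -> graph_nbhs M p (P_rel M b).
Proof. exact: (proj1 (G_openP HM _) P_open). Qed.

Lemma meets_orbit y z U : open U -> U y -> exists2 t, U t & orb M z t.
Proof.
move=> oU Uy; have [|t [Ut tz]] := B_simple z _ oU; first by exists y.
by exists t.
Qed.

Section IdealSet.
Variables (sigma : set (X * X)) (sigma_ideal : is_ideal_set M b sigma).

Let phi := boundary_of M b sigma.

Lemma ideal_nbhs p : sigma p -> graph_nbhs M p sigma.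
Proof. by have [_ /(G_openP HM) + _] := sigma_ideal; exact. Qed.

Lemma ideal_P p : sigma p -> P_rel M b p.
Proof. by have [+ _ _] := sigma_ideal; exact. Qed.

Lemma le_boundary x y : sigma (x, y) -> preceq b x (phi y).
Proof. by move=> xy; apply: osup_ub; split=> //; have [] := ideal_P xy. Qed.

Lemma ideal_right x t z :
  sigma (x, t) -> orb M z t -> preceq b t z -> sigma (x, z).
Proof.
have [_ _ idealP] := sigma_ideal; move=> xt tz le_tz.
exact: idealP (P_rel_refl x) _ xt.
Qed.

Lemma boundary_le y : preceq b (phi y) y.
Proof. by apply: osup_le => x [_ /ideal_P[]]. Qed.

(** The points (s, t) come from a partial homeomorphism through (x, y) whose graph
    is contained in sigma; by continuity its values stay above u close to y. *)
Lemma ideal_lift x y u : sigma (x, y) -> prec b u x ->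
  exists U, [/\ open U, U y & forall t, U t ->
    exists s, [/\ sigma (s, t), prec b u s & s = x -> t = y]].
Proof.
move=> sxy ux; have [Gxy _] := ideal_P sxy.
have := graph_nbhsI HM (ideal_nbhs sxy)
  (graph_nbhs_box HM Gxy (open_above b_cont u) ux openT I).
move=> /(graph_nbhs_lift HM)[U [oU Uy liftU]]; exists U; split=> // t /liftU.
by move=> [s [[sst [us _]] inj]]; exists s.
Qed.

Lemma boundary_mono y z : prec b y z -> preceq b (phi y) (phi z).
Proof.
move=> yz; apply: osup_le => x [_ sxy]; rewrite /preceq leNgt; apply/negP => zx.
have [U [oU Uy liftU]] := ideal_lift sxy zx.
have [t [Ut tz] orb_t] := meets_orbit z (openI oU (open_below b_cont z))
  (conj Uy yz).
have [s [sst zs _]] := liftU _ Ut.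
have := le_boundary (ideal_right sst orb_t (ltW tz)).
by rewrite /preceq leNgt => /negP; apply.
Qed.

Lemma boundary_sup y : ~ gap_below b y ->
  phi y = osup b [set phi t | t in [set t | prec b t y]].
Proof.
move=> ny; apply: (preceq_anti b_inj); last first.
  by apply: osup_le => _ [t ty <-]; exact: boundary_mono.
apply: osup_le => x [_ sxy]; rewrite /preceq leNgt; apply/negP => Sx.
have Sy : prec b (osup b [set phi t | t in [set t | prec b t y]]) y.
  by apply: lt_le_trans Sx _; have [] := ideal_P sxy.
have [U [oU Uy liftU]] := ideal_lift sxy Sx.
have [t Ut ty] := no_gap_approx X_compact b_cont b_inj oU Uy ny Sy.
have [s [sst Ss _]] := liftU _ Ut.
have : prec b (phi t) s.
  by apply: le_lt_trans Ss; apply: osup_ub; exists t.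
by rewrite /prec ltNge => /negP; apply; exact: le_boundary.
Qed.

(** A supremum with a gap below is attained. *)
Lemma boundary_gap_mem y : gap_below b (phi y) -> sigma (phi y, y).
Proof.
move=> [u [uy u_pred]].
have [x [Gx sxy] ux] := osup_gt X_compact b_cont uy.
suff -> : phi y = x by [].
apply: (preceq_anti b_inj); last exact: le_boundary.
by rewrite /preceq leNgt; apply/negP => xy; exact: (u_pred x).
Qed.

(** Close to a boundary point x = phi y with a gap below, the partial
    homeomorphism through (x, y) cannot take values below x, and takes the value
    x only at y. *)
Lemma boundary_gap_lift y : gap_below b (phi y) ->
  exists U, [/\ open U, U y &
    forall t, U t -> t <> y -> exists2 s, sigma (s, t) & prec b (phi y) s].
Proof.
move=> gap_y; have sy := boundary_gap_mem gap_y; have [u [uy u_pred]] := gap_y.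
have [U [oU Uy liftU]] := ideal_lift sy uy; exists U; split=> // t Ut ty.
have [s [sst us s_eq]] := liftU _ Ut; exists s => //.
rewrite /prec lt_neqAle leNgt; apply/andP; split; last first.
  by apply/negP => sphi; exact: (u_pred s).
by apply/eqP => /b_inj E; apply: ty; apply: s_eq; rewrite E.
Qed.

Lemma boundary_gap_below y : gap_below b (phi y) -> gap_below b y.
Proof.
move=> gap_y; apply: contrapT => ny; have [u [uy _]] := gap_y.
have [U [oU Uy liftU]] := boundary_gap_lift gap_y.
have uy' : prec b u y := lt_le_trans uy (boundary_le y).
have [t Ut ty] := no_gap_approx X_compact b_cont b_inj oU Uy ny uy'.
have [|s sst] := liftU _ Ut; first by move=> E; rewrite /prec E ltxx in ty.
rewrite /prec ltNge => /negP; apply.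
exact: le_trans (le_boundary sst) (boundary_mono ty).
Qed.

(** As X has no isolated points, a point y with a gap below is a limit of points
    of any given orbit lying strictly above y. *)
Lemma boundary_gap_strict y z :
  gap_below b (phi y) -> prec b y z -> prec b (phi y) (phi z).
Proof.
move=> gap_y yz; have [v [vy v_pred]] := boundary_gap_below gap_y.
have [U [oU Uy liftU]] := boundary_gap_lift gap_y.
pose V := U `&` [set t | prec b v t] `&` [set t | prec b t z].
have oV : open V.
  by apply: openI; [apply: openI => //; exact: open_above|exact: open_below].
have Vy : V y by [].
have [t0 Vt0 yt0] : exists2 t, V t & prec b y t.
  apply: contrapT => nV; have [_ /(_ y)] := cantor_compact_perfect X_cantor; apply.
  suff <- : V = [set y] by [].
  apply/seteqP; split=> [t Vt|_ ->//]; have [[_ vt] _] := Vt.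
  apply: (preceq_anti b_inj); rewrite /preceq leNgt; apply/negP => ty.
    by apply: nV; exists t.
  exact: (v_pred t).
have [t [[[Ut _] tz] yt] orb_t] := meets_orbit z
  (openI oV (open_above b_cont y)) (conj Vt0 yt0).
have [|s sst ys] := liftU _ Ut; first by move=> E; rewrite /= /prec E ltxx in yt.
exact: lt_le_trans ys (le_boundary (ideal_right sst orb_t (ltW tz))).
Qed.

Lemma boundary_of_is_boundary : is_boundary_function M b phi.
Proof.
split; [exact: boundary_le| |exact: boundary_mono|exact: boundary_sup].
move=> y gap_y; have sy := boundary_gap_mem gap_y; split.
- exact: ideal_P.
- exact: boundary_gap_below.
- by move=> z; exact: boundary_gap_strict.
have [n [k [i [j [ijy ij_sigma]]]]] := ideal_nbhs sy.
exists (mu_graph i j); split=> //; first exact: mu_graph_G_set.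
by move=> s t /ij_sigma; exact: le_boundary.
Qed.

End IdealSet.

(** * From boundary functions to ideal sets *)

(** The interior, in the groupoid, of the part of P on or below the graph of
    phi. *)
Definition ideal_below (phi : X -> X) : set (X * X) :=
  [set p | graph_nbhs M p [set q | P_rel M b q /\ preceq b q.1 (phi q.2)]].

(** An open set of pairs composed on both sides with the open set P remains open,
    and monotonicity of phi keeps it on or below the graph of phi. *)
Lemma ideal_below_ideal phi :
  is_boundary_function M b phi -> is_ideal_set M b (ideal_below phi).
Proof.
move=> phiP; split.
- by move=> p /graph_nbhs_mem[].
- by apply/(G_openP HM) => p; exact: graph_nbhs_nbhs.
move=> w x y z wx yz xy.
have wy := graph_nbhs_comp HM (P_rel_nbhs wx) xy.
apply: graph_nbhsS (graph_nbhs_comp HM wy (P_rel_nbhs yz)) => -[s u] /=.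
move=> [t' [[t [[Gst le_st] [[Gt le_tt'] le_t]]] [Gu le_t'u]]] /=; split.
  split; first exact: (G_rel_trans HM) (G_rel_trans HM Gst Gt) Gu.
  exact: le_trans (le_trans le_st le_tt') le_t'u.
apply: le_trans le_st _; apply: le_trans le_t _.
move: le_t'u; rewrite /= /preceq le_eqVlt => /predU1P[/b_inj->|t'u].
  exact: lexx.
exact: (bf_mono phiP).
Qed.

(** If phi y has a gap below, the definition of a boundary function puts
    (phi y, y) into the interior.  Otherwise, by density, the orbit of y accumulates
    at phi y from below, unless phi y is the minimum of X.  A point x of this orbit
    below phi y satisfies h t <= phi t for the partial homeomorphism h through
    (x, y) and all t close to y: if y has a gap below then t >= y for these t, and
    if not then phi t0 > x for some t0 below y, and t > t0 for these t. *)
Lemma ideal_below_boundary phi y :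
  is_boundary_function M b phi -> boundary_of M b (ideal_below phi) y = phi y.
Proof.
move=> phiP; apply: (preceq_anti b_inj).
  by apply: osup_le => x [_ /graph_nbhs_mem[]].
have phi_mono s t : preceq b s t -> preceq b (phi s) (phi t).
  rewrite /preceq le_eqVlt => /predU1P[/b_inj->|]; first exact: lexx.
  exact: (bf_mono phiP).
have [gap_y|no_gap] := pselect (gap_below b (phi y)).
  have [Py _ _ [N [[N_open _ _] Ny N_le]]] := bf_gap phiP gap_y.
  apply: osup_ub; split; first by case: Py.
  have := graph_nbhsI HM (P_rel_nbhs Py) (proj1 (G_openP HM N) N_open _ Ny).
  by apply: graph_nbhsS => -[s t] [Pst /N_le].
rewrite /preceq leNgt; apply/negP => S_phi.
have [u Su u_phi] := no_gap_between no_gap S_phi.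
have [x [Sx x_phi] orb_x] := meets_orbit y
  (openI (open_above b_cont (boundary_of M b (ideal_below phi) y))
    (open_below b_cont (phi y))) (conj Su u_phi).
suff /osup_ub : [set x | orb M y x /\ ideal_below phi (x, y)] x.
  by rewrite /preceq leNgt => /negP; apply.
split=> //.
have Pxy : P_rel M b (x, y).
  by split=> //; exact: le_trans (ltW x_phi) (bf_le phiP y).
(* r separates x from the values of phi close to y *)
suff [V [r [oV Vy xr V_le]]] : exists V r,
    [/\ open V, V y, prec b x r & forall t, V t -> preceq b r (phi t)].
  have := graph_nbhsI HM (P_rel_nbhs Pxy)
    (graph_nbhs_box HM orb_x (open_below b_cont r) xr oV Vy).
  apply: graph_nbhsS => -[s t] [Pst [/= sr /V_le rt]]; split=> //.
  exact: le_trans (ltW sr) rt.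
have [[v [vy v_pred]]|ny] := pselect (gap_below b y).
  exists [set t | prec b v t], (phi y); split=> //; first exact: open_above.
  move=> t vt; apply: phi_mono; rewrite /preceq leNgt; apply/negP => ty.
  exact: (v_pred t).
move: x_phi; rewrite /= {1}(bf_sup phiP ny).
move=> /(osup_gt X_compact b_cont)[_ [t0 t0y <-] xt0].
exists [set t | prec b t0 t], (phi t0); split=> //; first exact: open_above.
by move=> t /ltW; exact: phi_mono.
Qed.

(** * Two ideal sets with the same boundary function *)

Lemma P_ideal : is_ideal_set M b (P_rel M b).
Proof.
split=> // w x y z [Gwx wx] [Gyz yz] [Gxy xy]; split.
  exact: (G_rel_trans HM) Gwx (G_rel_trans HM Gxy Gyz).
exact: le_trans wx (le_trans xy yz).
Qed.

Definition P_above_min : set (X * X) :=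
  [set p | P_rel M b p /\ prec b (osup b set0) p.2].

Lemma P_above_min_ideal : is_ideal_set M b P_above_min.
Proof.
split; first by move=> p [].
  apply/(G_openP HM) => p [Pp min_p].
  have := graph_nbhsI HM (P_rel_nbhs Pp) (graph_nbhs_box HM (proj1 Pp) openT I
    (open_above b_cont (osup b set0)) min_p).
  by apply: graph_nbhsS => q [Pq [_ qmin]].
move=> w x y z wx yz [xy /= min_y]; split.
  by have [_ _ idealP] := P_ideal; exact: idealP wx yz xy.
by have [_ le_yz] := yz; exact: lt_le_trans le_yz.
Qed.

(** The two ideal sets differ only at (p, p), p the minimum of X, and the supremum
    of the empty set is p. *)
Lemma P_above_min_boundary y :
  boundary_of M b P_above_min y = boundary_of M b (P_rel M b) y.
Proof.
have [min_y|] := boolP (b (osup b set0) < b y).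
  congr osup; apply/seteqP; split=> x [orb_x]; first by case.
  by move=> Pxy; split.
rewrite -leNgt => le_y; have y_min z : preceq b y z.
  exact: le_trans le_y (osup0_le X_compact b_cont z).
transitivity y; apply: (preceq_anti b_inj); rewrite ?y_min //.
  exact: (boundary_le P_above_min_ideal).
exact: (boundary_le P_ideal).
Qed.

Lemma P_above_min_neq : P_above_min <> P_rel M b.
Proof.
move=> E; have : P_above_min (osup b set0, osup b set0).
  by rewrite E; exact: P_rel_refl.
by move=> [_]; rewrite /= /prec ltxx.
Qed.

End Boundaries.

Theorem mainTheorem7 (R : realType) (X : ptopologicalType)
  (M : matrix_units X) (b : X -> R)
  (X_cantor : is_cantor_space X)
  (M_system : is_matrix_unit_system M)
  (B_simple : minimal_groupoid M)
  (b_cont : continuous b)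
  (b_inj : injective b)
  (P_open : G_open M (P_rel M b)) :
  exists Phi : ideal_set M b -> boundary_function M b,
    [/\ (forall sigma y, val (Phi sigma) y = boundary_of M b (val sigma) y),
        ~ injective Phi &
        exists2 F : ideal_class M b -> bf_class M b,
          bijective F &
          forall sigma, F (class_of_ideal sigma) = class_of_bf (Phi sigma)].
Proof.
pose Phi (sigma : ideal_set M b) : boundary_function M b := SigSub (mem_set
  (boundary_of_is_boundary X_cantor M_system B_simple b_cont b_inj
    (set_valP sigma))).
pose Psi (phi : boundary_function M b) : ideal_set M b := SigSub (mem_set
  (ideal_below_ideal M_system b_inj P_open (set_valP phi))).
have PsiK phi : Phi (Psi phi) = phi.
  apply/val_inj/funext => y; apply: ideal_below_boundary => //.
  exact: set_valP.
have class_PhiP sigma tau :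
    class_of_ideal sigma = class_of_ideal tau <->
    class_of_bf (Phi sigma) = class_of_bf (Phi tau).
  split=> /eqmodP E; apply/eqmodP; exact: E.
exists Phi; split=> //.
  pose PP : ideal_set M b := SigSub (mem_set (P_ideal M_system P_open)).
  pose PP' : ideal_set M b := SigSub (mem_set
    (P_above_min_ideal M_system b_cont P_open)).
  move=> /(_ PP' PP) Phi_inj; apply: (@P_above_min_neq R X M b M_system).
  suff /Phi_inj/(congr1 val) : Phi PP' = Phi PP by [].
  apply/val_inj/funext => y; exact: P_above_min_boundary.
exists (fun c => class_of_bf (Phi (repr c))).
  exists (fun d => class_of_ideal (Psi (repr d))) => [c|d].
    rewrite -[RHS]reprK; apply/class_PhiP; rewrite PsiK; exact: reprK.
  transitivity (class_of_bf (Phi (Psi (repr d)))).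
      by apply/class_PhiP; exact: reprK.
    by rewrite PsiK; exact: reprK.
by move=> sigma; apply/class_PhiP; exact: reprK.
Qed.
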